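(* For every countable graph $G$ the following are equivalent: (a) $G$ contains no subdivision of $K_{\aleph_0}$; (b) $G$ is a spanning subgraph of a chordal graph that contains no $K_{\aleph_0}$ and has a simplicial decomposition in which each simplicial summand is a finite complete graph; (c) $G$ has a tree-decomposition such that for every infinite set $X\subseteq V(G)$ there are distinct $v,w\in X$ that lie in no common bag; (d) $G$ is a spanning subgraph of a chordal graph with no $K_{\aleph_0}$ subgraph; (e) $G$ is a spanning subgraph of a graph $G'$ that has a finite chordal partition $\mathcal{P}$ such that $G'/\mathcal{P}$ has no $K_{\aleph_0}$ subgraph; (f) $G$ contains no model of $K_{\aleph_0}$ in which every branch set has finite radius.
   Context: Graphs are simple and countable. A graph is chordal if every cycle of length at least 4 has a chord. Simplicial decomposition: let $H_1,H_2,\dots$ be pairwise disjoint graphs containing no $K_{\aleph_0}$ and no finite separating complete subgraph (the empty graph counts as complete). Let $G_1=H_1$, and let $G_{n+1}$ be obtained from $G_n$ and $H_{n+1}$ by identifying a $K_p$ subgraph of $G_n$ with a $K_p$ subgraph of $H_{n+1}$ for some $p\ge 0$. If $G=\bigcup_n G_n$ contains no $K_{\aleph_0}$, then $H_1,H_2,\dots$ form a simplicial decomposition of $G$ with simplicial summands $H_i$. A tree-decomposition is a family of bags indexed by a tree with every edge inside a bag and each vertex's bags forming a nonempty subtree. A partition $\mathcal{P}$ of $G'$ is a set of nonempty pairwise disjoint vertex sets covering $V(G')$; it is finite if every part is finite; the quotient $G'/\mathcal{P}$ has vertex set $\mathcal{P}$, with distinct parts adjacent iff some edge of $G'$ joins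 them; $\mathcal{P}$ is chordal if $G'/\mathcal{P}$ is chordal. A model of $H$ in $G$ is a family $(X_v)_{v\in V(H)}$ of pairwise disjoint connected subgraphs (branch sets) such that for each edge $vw$ of $H$ some edge of $G$ joins $X_v$ and $X_w$. *)

(* Defs.v *)
From Stdlib Require Import Arith List.
Import ListNotations.
Set Implicit Arguments.

Record graph (V : Type) := Graph {
  adj : V -> V -> Prop;
  adj_sym : forall x y, adj x y -> adj y x;
  adj_irr : forall x, ~ adj x x
}.
Arguments adj {V} g x y.

Definition countable (V : Type) : Prop :=
  exists f : V -> nat, forall x y, f x = f y -> x = y.

Definition finite_set {V : Type} (X : V -> Prop) : Prop :=
  exists l : list V, forall x, X x -> In x l.
Definition infinite_set {V : Type} (X : V -> Prop) : Prop := ~ finite_set X.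

Definition spanning_subgraph {V : Type} (G G' : graph V) : Prop :=
  forall x y, adj G x y -> adj G' x y.

Definition walk {X : Type} (R : X -> X -> Prop) (x y : X) (n : nat) (p : nat -> X) : Prop :=
  p 0 = x /\ p n = y /\ forall k, k < n -> R (p k) (p (S k)).

Definition is_cycle {V : Type} (G : graph V) (c : nat -> V) (n : nat) : Prop :=
  (forall i j, i < n -> j < n -> c i = c j -> i = j) /\
  (forall i, i < n -> adj G (c i) (c (Nat.modulo (S i) n))).

Definition has_chord {V : Type} (G : graph V) (c : nat -> V) (n : nat) : Prop :=
  exists i j, i < n /\ j < n /\ adj G (c i) (c j) /\
    j <> Nat.modulo (S i) n /\ i <> Nat.modulo (S j) n.

Definition chordal {V : Type} (G : graph V) : Prop :=
  forall (n : nat) (c : nat -> V), 4 <= n -> is_cycle G c n -> has_chord G c n.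

Definition has_K_aleph0 {V : Type} (G : graph V) : Prop :=
  exists f : nat -> V, (forall i j, f i = f j -> i = j) /\
    (forall i j, i <> j -> adj G (f i) (f j)).

Definition has_TK_aleph0 {V : Type} (G : graph V) : Prop :=
  exists (f : nat -> V) (P : nat -> nat -> nat -> V) (L : nat -> nat -> nat),
    (forall i j, f i = f j -> i = j) /\
    forall i j, i < j ->
      1 <= L i j /\ P i j 0 = f i /\ P i j (L i j) = f j /\
      (forall k, k < L i j -> adj G (P i j k) (P i j (S k))) /\
      (forall k k', k <= L i j -> k' <= L i j -> P i j k = P i j k' -> k = k') /\
      (forall k m, 0 < k < L i j -> P i j k <> f m) /\
      (forall i' j' k k', i' < j' -> (i, j) <> (i', j') ->
          0 < k < L i j -> 0 < k' < L i' j' -> P i j k <> P i' j' k').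

(** Simplicial decomposition of G all of whose simplicial summands are
    finite complete graphs, described through the images H n of the summands
    in G (H 0 is the image of H_1, etc.).  Summands may be empty (K_0),
    which allows finite sequences of summands. *)
Definition fin_complete_simplicial_decomposition {V : Type} (G : graph V) : Prop :=
  exists H : nat -> V -> Prop,
    (forall n, finite_set (H n)) /\
    (forall x, exists n, H n x) /\
    (forall x y, adj G x y <-> (x <> y /\ exists n, H n x /\ H n y)) /\
    (* the part of H_{n+1} identified with G_n is complete in G_n *)
    (forall n x y, H (S n) x -> H (S n) y -> x <> y ->
        (exists k, k <= n /\ H k x) -> (exists k, k <= n /\ H k y) ->
        exists k, k <= n /\ H k x /\ H k y).

Definition is_tree {I : Type} (T : graph I) : Prop :=
  inhabited I /\
  (forall s t, exists n p, walk (adj T) s t n p) /\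
  (forall n (c : nat -> I), 3 <= n -> ~ is_cycle T c n).

Definition tree_decomposition {V I : Type} (G : graph V) (T : graph I)
    (B : I -> V -> Prop) : Prop :=
  is_tree T /\
  (forall x y, adj G x y -> exists t, B t x /\ B t y) /\
  (forall v, exists t, B t v) /\
  (forall v s t, B s v -> B t v ->
      exists n p, walk (adj T) s t n p /\ forall k, k <= n -> B (p k) v).

Definition quotient_adj {V Q : Type} (G : graph V) (P : Q -> V -> Prop) (q q' : Q) : Prop :=
  q <> q' /\ exists x y, P q x /\ P q' y /\ adj G x y.

Lemma quotient_adj_sym {V Q : Type} (G : graph V) (P : Q -> V -> Prop) :
  forall q q', quotient_adj G P q q' -> quotient_adj G P q' q.
Proof.
  intros q q' [Hne [x [y [Hx [Hy Hxy]]]]]; split.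
  - intro E; apply Hne; symmetry; exact E.
  - exists y, x; repeat split; auto; apply adj_sym; exact Hxy.
Qed.

Lemma quotient_adj_irr {V Q : Type} (G : graph V) (P : Q -> V -> Prop) :
  forall q, ~ quotient_adj G P q q.
Proof. intros q [H _]; apply H; reflexivity. Qed.

Definition quotient {V Q : Type} (G : graph V) (P : Q -> V -> Prop) : graph Q :=
  @Graph Q (quotient_adj G P) (@quotient_adj_sym V Q G P) (@quotient_adj_irr V Q G P).

Definition is_partition {V Q : Type} (P : Q -> V -> Prop) : Prop :=
  (forall q, exists x, P q x) /\ (forall x, exists! q, P q x).

Definition finite_partition {V Q : Type} (P : Q -> V -> Prop) : Prop :=
  is_partition P /\ forall q, finite_set (P q).

Definition has_finite_radius_K_aleph0_model {V : Type} (G : graph V) : Prop :=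
  exists (X : nat -> V -> Prop) (E : nat -> V -> V -> Prop),
    (forall i x y, E i x y -> X i x /\ X i y /\ adj G x y) /\
    (forall i x y, E i x y -> E i y x) /\
    (forall i j x, i <> j -> X i x -> X j x -> False) /\
    (forall i, exists x, X i x) /\
    (forall i x y, X i x -> X i y -> exists n p, walk (E i) x y n p) /\
    (forall i j, i <> j -> exists x y, X i x /\ X j y /\ adj G x y) /\
    (forall i, exists c r, X i c /\
        forall x, X i x -> exists n p, n <= r /\ walk (E i) c x n p).

(* Main.v *)
(** Call two vertices inseparable if no finite set of other vertices separates them.
    A subdivided infinite clique exists as soon as some infinite set is pairwise
    inseparable (greedily), and its branch vertices are pairwise inseparable.

    From (a): enumerate V by an injection f and join x to y, f x < f y, whenever x is
    adjacent to the component C y of y in G[f >= f y].  This fill-in graph is chordal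
    (f is an elimination ordering), and the finite bags {y} + N(C y) give both
    decompositions.  Two members x, y of an infinite clique of the fill-in are both
    adjacent to C u for clique members u arbitrarily late in the enumeration, and
    C u avoids any prescribed finite set once u is late enough, so x and y are
    inseparable.

    To (f): each of (b), (c), (d), (e) yields a supergraph K of G without infinite
    clique in which non-adjacent vertices are separated by finite sets.  In a chordal
    graph the separators are cliques; a tree-decomposition separates by the
    intersection of two adjacent bags; a quotient is replaced by its blow-up.  Such
    a K has no infinite clique model with branch sets of finite radius. *)

From Stdlib Require Import Arith List Lia Classical IndefiniteDescription.
Require Import Defs.
Import ListNotations.

(** * Finite and infinite sets *)

Lemma least_nat (P : nat -> Prop) n :
  P n -> exists m, P m /\ forall k, k < m -> ~ P k.
Proof.
  induction n as [n IH] using lt_wf_ind; intros Hn.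
  destruct (classic (exists k, k < n /\ P k)) as [[k [Hk Pk]]|H].
  - exact (IH k Hk Pk).
  - exists n; split; [exact Hn|]; intros k Hk Pk; apply H; eauto.
Qed.

Lemma no_injection_into_list {V : Type} (l : list V) (g : nat -> V) :
  (forall i j, g i = g j -> i = j) -> (forall i, In (g i) l) -> False.
Proof.
  intros inj Hl.
  assert (H : length (map g (seq 0 (S (length l)))) <= length l).
  { apply NoDup_incl_length.
    - apply NoDup_map_NoDup_ForallPairs; [|apply seq_NoDup].
      intros a b _ _; apply inj.
    - intros x Hx; apply in_map_iff in Hx; destruct Hx as [i [<- _]]; auto. }
  rewrite length_map, length_seq in H; lia.
Qed.

Lemma infinite_set_avoids {V : Type} (X : V -> Prop) (l : list V) :
  infinite_set X -> exists x, X x /\ ~ In x l.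
Proof.
  intros HX; apply NNPP; intros H; apply HX; exists l; intros x Xx.
  apply NNPP; intros Hx; apply H; eauto.
Qed.

Lemma infinite_set_injection {V : Type} (X : V -> Prop) :
  infinite_set X ->
  exists g : nat -> V, (forall i, X (g i)) /\ (forall i j, g i = g j -> i = j).
Proof.
  intros HX.
  destruct (functional_choice _ (fun l => infinite_set_avoids X l HX)) as [c Hc].
  set (pre := fix pre n := match n with 0 => nil | S m => c (pre m) :: pre m end).
  assert (Hpre : forall i j, i < j -> In (c (pre i)) (pre j)).
  { intros i j; induction j as [|j IH]; intros Hij; [lia|simpl].
    destruct (Nat.eq_dec i j) as [->|]; [left; reflexivity|right; apply IH; lia]. }
  exists (fun n => c (pre n)); split.
  - intros i; apply Hc.
  - intros i j E; destruct (Nat.lt_trichotomy i j) as [L|[L|L]]; [|exact L|].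
    + exfalso; apply (proj2 (Hc (pre j))); rewrite <- E; auto.
    + exfalso; apply (proj2 (Hc (pre i))); rewrite E; auto.
Qed.

Lemma infinite_range {V : Type} (g : nat -> V) :
  (forall i j, g i = g j -> i = j) -> infinite_set (fun x => exists i, x = g i).
Proof. intros inj [l Hl]; apply (no_injection_into_list l g inj); eauto. Qed.

Lemma infinite_clique_K_aleph0 {V : Type} (G : graph V) (X : V -> Prop) :
  infinite_set X -> (forall x y, X x -> X y -> x <> y -> adj G x y) ->
  has_K_aleph0 G.
Proof.
  intros HX Hadj; destruct (infinite_set_injection X HX) as [g [Xg inj]].
  exists g; split; [exact inj|]; intros i j Hij; apply Hadj; auto.
Qed.

(** Membership in [X] can be decided classically, so the covering list of [finite_set] is filtered
    to one that lists [X] exactly. *)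
Lemma finite_set_list {V : Type} (X : V -> Prop) :
  finite_set X -> exists l, forall x, In x l <-> X x.
Proof.
  intros [l Hl].
  assert (H : forall l, exists l', forall z, In z l' <-> In z l /\ X z).
  { clear. induction l as [|a l [l' IH]].
    - exists nil; intros z; simpl; tauto.
    - destruct (classic (X a)); [exists (a :: l')|exists l'];
        intros z; simpl; rewrite IH; intuition (subst; auto); contradiction. }
  destruct (H l) as [l' Hl']; exists l'; intros z; rewrite Hl'; intuition.
Qed.

(** * Walks inside a vertex set and shortest paths *)

(** Every vertex of the walk, both ends included, lies in [A]; separation by a finite set is then
    non-reachability inside its complement. *)
Inductive reach {V : Type} (R : V -> V -> Prop) (A : V -> Prop) (x : V) : V -> Prop :=
| reach_refl : A x -> reach R A x x
| reach_step y z : reach R A x y -> R y z -> A z -> reach R A x z.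

Lemma reach_target {V : Type} (R : V -> V -> Prop) A x y : reach R A x y -> A y.
Proof. destruct 1; auto. Qed.

Lemma reach_trans {V : Type} (R : V -> V -> Prop) A x y z :
  reach R A x y -> reach R A y z -> reach R A x z.
Proof. intros H; induction 1; eauto using @reach_step. Qed.

Lemma reach_edge {V : Type} (R : V -> V -> Prop) (A : V -> Prop) x y :
  A x -> A y -> R x y -> reach R A x y.
Proof. intros; eapply reach_step; eauto using @reach_refl. Qed.

Lemma reach_sym {V : Type} (R : V -> V -> Prop) A x y :
  (forall u v, R u v -> R v u) -> reach R A x y -> reach R A y x.
Proof.
  intros HR; induction 1 as [|y z H IH Ryz Az]; [apply reach_refl; assumption|].
  apply reach_trans with y; [|exact IH].
  apply reach_edge; auto; exact (reach_target _ _ _ _ H).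
Qed.

(** Edges contracted by [h] are skipped, which is needed for projecting a blow-up. *)
Lemma reach_map {V W : Type} (h : V -> W) (R : V -> V -> Prop) (S : W -> W -> Prop)
    (A : V -> Prop) (B : W -> Prop) x y :
  (forall u, A u -> B (h u)) ->
  (forall u v, A u -> A v -> R u v -> h u = h v \/ S (h u) (h v)) ->
  reach R A x y -> reach S B (h x) (h y).
Proof.
  intros HA HR; induction 1 as [|y z H IH Ryz Az]; [apply reach_refl; auto|].
  destruct (HR y z (reach_target _ _ _ _ H) Az Ryz) as [E|E]; [congruence|].
  eapply reach_step; eauto.
Qed.

Lemma reach_mono {V : Type} (R S : V -> V -> Prop) (A B : V -> Prop) x y :
  (forall u, A u -> B u) -> (forall u v, A u -> A v -> R u v -> S u v) ->
  reach R A x y -> reach S B x y.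
Proof. intros HA HR; apply (reach_map (fun u => u)); auto. Qed.

Lemma walk_reach {V : Type} (R : V -> V -> Prop) (A : V -> Prop) x y n p :
  walk R x y n p -> (forall k, k <= n -> A (p k)) -> reach R A x y.
Proof.
  intros [<- [<- Hp]] HA.
  assert (H : forall k, k <= n -> reach R A (p 0) (p k)); [|apply H; lia].
  induction k as [|k IH]; intros Hk; [apply reach_refl; auto|].
  eapply reach_step; [apply IH; lia|apply Hp; lia|auto].
Qed.

Lemma reach_walk {V : Type} (R : V -> V -> Prop) (A : V -> Prop) x y :
  reach R A x y -> exists n p, walk R x y n p /\ forall k, k <= n -> A (p k).
Proof.
  induction 1 as [Ax|y z _ [n [p [[H0 [Hn Hp]] HA]]] Ryz Az].
  - exists 0, (fun _ => x); repeat split; auto; lia.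
  - exists (S n), (fun k => if k <=? n then p k else z); repeat split; cbv beta.
    + exact H0.
    + rewrite (proj2 (Nat.leb_gt _ _)); [reflexivity|lia].
    + intros k Hk; rewrite (proj2 (Nat.leb_le k n)) by lia.
      destruct (Nat.leb_spec (S k) n); [apply Hp; lia|].
      replace k with n by lia; congruence.
    + intros k Hk; destruct (Nat.leb_spec k n); auto.
Qed.

(** A walk of least length works: a forward chord or a repeated vertex would shorten it. *)
Lemma reach_induced_path {V : Type} (R : V -> V -> Prop) (A : V -> Prop) x y :
  reach R A x y -> exists n p, walk R x y n p /\
    (forall k, k <= n -> A (p k)) /\
    (forall i j, i <= n -> j <= n -> p i = p j -> i = j) /\
    (forall i j, i < j -> j <= n -> R (p i) (p j) -> j = S i).
Proof.
  intros H; apply reach_walk in H; destruct H as [n0 H].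
  destruct (least_nat (fun n => exists p, walk R x y n p /\ forall k, k <= n -> A (p k))
              n0 H) as [n [[p [[H0 [Hn Hp]] HA]] Hmin]].
  assert (Hskip : forall i j, i < j -> j <= n -> R (p i) (p j) -> j = S i).
  { intros i j Hij Hjn Rij; apply NNPP; intros Hne.
    (* An edge from [p i] to [p j] bypasses the [j - S i] vertices strictly between them. *)
    apply (Hmin (n - (j - S i))); [lia|].
    exists (fun k => if k <=? i then p k else p (k + (j - S i))).
    repeat split; cbv beta; auto.
    - rewrite (proj2 (Nat.leb_gt _ _)) by lia; rewrite <- Hn; f_equal; lia.
    - intros k Hk; destruct (Nat.leb_spec k i), (Nat.leb_spec (S k) i);
        [apply Hp; lia| |lia|apply (Hp (k + (j - S i))); lia].
      replace k with i by lia; replace (S i + (j - S i)) with j by lia; exact Rij.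
    - intros k Hk; destruct (Nat.leb_spec k i); apply HA; lia. }
  assert (Hinj : forall i j, i < j -> j <= n -> p i <> p j).
  (* If [p i = p j], then the walk can stop at [i] when [j = n]; otherwise [p i] is joined to
     [p (S j)], a forbidden skip. *)
  { intros i j Hij Hjn E; destruct (Nat.eq_dec j n) as [->|Hne].
    - apply (Hmin i Hij); exists p; repeat split; auto; try congruence;
        intros; [apply Hp|apply HA]; lia.
    - assert (S j = S i); [apply Hskip; [lia|lia|]|lia].
      rewrite E; apply Hp; lia. }
  exists n, p; repeat split; auto.
  intros i j Hi Hj E; destruct (Nat.lt_trichotomy i j) as [L|[L|L]]; auto;
    exfalso; [apply (Hinj i j)|apply (Hinj j i)]; auto.
Qed.

(** * Separation by finite sets *)

Definition finitely_separated {V : Type} (G : graph V) (x y : V) : Prop :=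
  exists F : list V, ~ In x F /\ ~ In y F /\
    ~ reach (adj G) (fun z => ~ In z F) x y.

Definition finitely_separable {V : Type} (G : graph V) : Prop :=
  forall x y, x <> y -> ~ adj G x y -> finitely_separated G x y.

Lemma not_separated_reach {V : Type} (G : graph V) x y (F : list V) :
  ~ finitely_separated G x y -> ~ In x F -> ~ In y F ->
  reach (adj G) (fun z => ~ In z F) x y.
Proof. intros H Hx Hy; apply NNPP; intros Hr; apply H; exists F; auto. Qed.

(** * Chordal graphs *)

Lemma mod_succ_cases i n : i < n ->
  (S i < n /\ S i mod n = S i) \/ (S i = n /\ S i mod n = 0).
Proof.
  intros Hi; destruct (Nat.eq_dec (S i) n) as [E|E].
  - right; split; auto; rewrite E; apply Nat.Div0.mod_same.
  - left; split; [lia|]; apply Nat.mod_small; lia.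
Qed.

(** A shortest path from [z] to [z'] through [C] closes with [x] to a cycle. If [z] and [z'] were
    not adjacent, its length would be at least 4 and it would have no chord, as [x] has no neighbour
    in [C]. *)
Lemma chordal_common_neighbours {V : Type} (G : graph V) (x z z' : V) (C : V -> Prop) :
  chordal G -> (forall u, C u -> u <> x /\ ~ adj G x u) ->
  adj G x z -> adj G x z' -> z <> z' ->
  reach (adj G) (fun u => u = z \/ u = z' \/ C u) z z' -> adj G z z'.
Proof.
  intros HG HC Hz Hz' Hne Hr; apply NNPP; intros Hn.
  destruct (reach_induced_path _ _ _ _ Hr) as [k [p [[P0 [Pk Hp]] [HA [Hinj Hskip]]]]].
  assert (Hk : 2 <= k).
  { destruct k as [|[|k]]; [congruence| |lia].
    exfalso; apply Hn; rewrite <- P0, <- Pk; apply Hp; lia. }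
  assert (Hint : forall i, i <= k -> adj G x (p i) -> i = 0 \/ i = k).
  { intros i Hi Hx; destruct (HA i Hi) as [E|[E|E]].
    - left; apply Hinj; [lia|lia|congruence].
    - right; apply Hinj; [lia|lia|congruence].
    - exfalso; exact (proj2 (HC _ E) Hx). }
  assert (Hnx : forall i, i <= k -> p i <> x).
  { intros i Hi E; destruct (HA i Hi) as [E'|[E'|E']].
    - apply (adj_irr G x); congruence.
    - apply (adj_irr G x); congruence.
    - exact (proj1 (HC _ E') E). }
  set (c := fun i => match i with 0 => x | S i => p i end).
  destruct (HG (k + 2) c) as [i [j [Hi [Hj [Hij [H1 H2]]]]]]; [lia| |].
  - split.
    + intros [|i] [|j] Hi Hj E; simpl in E; auto.
      * exfalso; apply (Hnx j); [lia|auto].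
      * exfalso; apply (Hnx i); [lia|auto].
      * f_equal; apply Hinj; auto; lia.
    + intros i Hi; destruct (mod_succ_cases i (k + 2) Hi) as [[L ->]|[L ->]].
      * destruct i as [|i]; simpl; [congruence|apply Hp; lia].
      * destruct i as [|i]; [lia|]; simpl; apply adj_sym.
        replace i with k by lia; congruence.
  - assert (Hmod : forall m, m < k + 1 -> S m mod (k + 2) = S m)
      by (intros; apply Nat.mod_small; lia).
    assert (Hmod' : S (S k) mod (k + 2) = 0)
      by (replace (S (S k)) with (k + 2) by lia; apply Nat.Div0.mod_same).
    destruct i as [|i], j as [|j]; simpl in Hij.
    + exact (adj_irr G x Hij).
    + destruct (Hint j) as [->| ->]; [lia|exact Hij| |].
      * apply H1; rewrite Hmod; lia.
      * apply H2; rewrite Hmod'; reflexivity.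
    + apply adj_sym in Hij; destruct (Hint i) as [->| ->]; [lia|exact Hij| |].
      * apply H2; rewrite Hmod; lia.
      * apply H1; rewrite Hmod'; reflexivity.
    + destruct (Nat.lt_trichotomy i j) as [L|[->|L]].
      * apply Hskip in Hij; [|lia|lia]; apply H1; rewrite Hmod; lia.
      * exact (adj_irr G _ Hij).
      * apply adj_sym, Hskip in Hij; [|lia|lia]; apply H2; rewrite Hmod; lia.
Qed.

(* The separator of x and y is the neighbourhood of the component of G - N[x]
   containing y: it is a clique, hence finite. *)
Lemma chordal_finitely_separable {V : Type} (G : graph V) :
  chordal G -> ~ has_K_aleph0 G -> finitely_separable G.
Proof.
  intros HG HK x y Hxy Hadj.
  set (N := fun u => u <> x /\ ~ adj G x u).
  set (C := reach (adj G) N y).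
  set (F := fun z => adj G x z /\ exists u, C u /\ adj G u z).
  assert (Cy : C y) by (apply reach_refl; split; auto).
  assert (CN : forall u, C u -> N u) by (intros u; apply reach_target).
  assert (Cs : forall u, C u -> reach (adj G) C y u).
  { induction 1; [apply reach_refl; auto|]; eapply reach_step; eauto.
    eapply reach_step; eauto. }
  destruct (classic (finite_set F)) as [Hfin|Hinf];
    [destruct (finite_set_list F Hfin) as [l Hl]|].
  - exists l; rewrite !Hl; repeat split.
    + intros [H _]; exact (adj_irr G _ H).
    + intros [H _]; auto.
    + intros Hr; apply reach_sym in Hr; [|apply adj_sym].
      (* A walk avoiding [F] cannot leave [C]: its next vertex would be a neighbour of [x], hence in
         [F], or [x] itself, which has no neighbour in [C]. *)
      assert (HC : forall u, reach (adj G) (fun z => ~ In z l) y u -> C u).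
      { induction 1 as [|u w _ IH Huw Hw]; [exact Cy|].
        rewrite Hl in Hw.
        destruct (classic (adj G x w)) as [Hx|Hx]; [exfalso; apply Hw; split; eauto|].
        destruct (classic (w = x)) as [->|Hwx].
        - exfalso; exact (proj2 (CN u IH) (adj_sym _ _ _ Huw)).
        - eapply reach_step; eauto; split; auto. }
      exact (proj1 (CN x (HC x Hr)) eq_refl).
  - exfalso; apply HK; apply (infinite_clique_K_aleph0 G F Hinf).
    intros z z' [Hz [u [Cu Hu]]] [Hz' [u' [Cu' Hu']]] Hne.
    apply (chordal_common_neighbours G x z z' C); auto.
    apply reach_step with u'; auto.
    apply reach_trans with u; [apply reach_edge; auto; apply adj_sym; auto|].
    apply reach_mono with (R := adj G) (A := C); auto.
    apply reach_trans with y; [apply reach_sym; [apply adj_sym|]|]; auto.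
Qed.

(** * Blow-ups and finite partitions *)

Lemma finite_preimage {V Q : Type} (h : V -> Q) (l : list Q) :
  (forall q, finite_set (fun x => h x = q)) -> finite_set (fun x => In (h x) l).
Proof.
  intros Hfin; induction l as [|q l [l1 H1]]; [exists nil; auto|].
  destruct (Hfin q) as [l2 H2]; exists (l2 ++ l1); intros x [E|Hx];
    apply in_or_app; auto.
Qed.

(** Fibres of [h] become cliques, and fibres over adjacent vertices are completely joined. *)
Definition blow_up_adj {V Q : Type} (H : graph Q) (h : V -> Q) (x y : V) : Prop :=
  x <> y /\ (h x = h y \/ adj H (h x) (h y)).

Lemma blow_up_adj_sym {V Q : Type} (H : graph Q) (h : V -> Q) x y :
  blow_up_adj H h x y -> blow_up_adj H h y x.
Proof. intros [Hne [E|E]]; split; auto; right; apply adj_sym; auto. Qed.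

Lemma blow_up_adj_irr {V Q : Type} (H : graph Q) (h : V -> Q) x :
  ~ blow_up_adj H h x x.
Proof. intros [Hne _]; auto. Qed.

Definition blow_up {V Q : Type} (H : graph Q) (h : V -> Q) : graph V :=
  Graph (blow_up_adj H h) (blow_up_adj_sym H h) (blow_up_adj_irr H h).

(** The preimage of a finite separator is finite, and it separates because walks project along
    [h]. *)
Lemma blow_up_finitely_separable {V Q : Type} (H : graph Q) (h : V -> Q) :
  (forall q, finite_set (fun x => h x = q)) ->
  finitely_separable H -> finitely_separable (blow_up H h).
Proof.
  intros Hfin Hsep x y Hxy Hadj.
  destruct (Hsep (h x) (h y)) as [F [Hx [Hy Hr]]].
  - intros E; apply Hadj; split; auto.
  - intros E; apply Hadj; split; auto.
  - destruct (finite_set_list _ (finite_preimage h F Hfin)) as [F' HF'].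
    exists F'; rewrite !HF'; repeat split; auto.
    intros Hr'; apply Hr; revert Hr'; apply reach_map.
    + intros u; rewrite HF'; auto.
    + intros u v _ _ [_ E]; exact E.
Qed.

Lemma blow_up_K_aleph0 {V Q : Type} (H : graph Q) (h : V -> Q) :
  (forall q, finite_set (fun x => h x = q)) ->
  has_K_aleph0 (blow_up H h) -> has_K_aleph0 H.
Proof.
  intros Hfin [g [inj Hg]].
  apply (infinite_clique_K_aleph0 H (fun q => exists i, q = h (g i))).
  - intros [l Hl]; destruct (finite_preimage h l Hfin) as [l' Hl'].
    apply (no_injection_into_list l' g inj); eauto.
  - intros q q' [i ->] [j ->] Hne.
    destruct (Hg i j) as [_ [E|E]]; [congruence|contradiction|exact E].
Qed.

(** [K] is the blow-up of the quotient; it contains [G] because every edge lies in a part or joins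
    two adjacent parts. *)
Lemma quotient_finitely_separable {V Q : Type} (G : graph V) (P : Q -> V -> Prop) :
  finite_partition P -> finitely_separable (quotient G P) ->
  ~ has_K_aleph0 (quotient G P) ->
  exists K : graph V, spanning_subgraph G K /\ finitely_separable K /\
    ~ has_K_aleph0 K.
Proof.
  intros [[_ HP] Hfin] Hsep HK.
  destruct (functional_choice (fun x q => P q x)) as [h Hh].
  { intros x; destruct (HP x) as [q [Hq _]]; eauto. }
  assert (Hfib : forall q, finite_set (fun x => h x = q)).
  { intros q; destruct (Hfin q) as [l Hl]; exists l; intros x <-; auto. }
  exists (blow_up (quotient G P) h); split; [|split].
  - intros x y Hxy; split; [intros ->; exact (adj_irr _ _ Hxy)|].
    destruct (classic (h x = h y)) as [E|E]; [auto|right; split; [exact E|]].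
    exists x, y; auto.
  - apply blow_up_finitely_separable; auto.
  - intros H; apply HK, (blow_up_K_aleph0 _ h Hfib H).
Qed.

(** * Tree-decompositions *)

(** With every bag made complete, the condition on infinite sets in (c) says that there is no
    infinite clique. *)
Definition common_bag_adj {V I : Type} (B : I -> V -> Prop) (x y : V) : Prop :=
  x <> y /\ exists t, B t x /\ B t y.

Lemma common_bag_adj_sym {V I : Type} (B : I -> V -> Prop) x y :
  common_bag_adj B x y -> common_bag_adj B y x.
Proof. intros [Hne [t [Hx Hy]]]; split; eauto. Qed.

Lemma common_bag_adj_irr {V I : Type} (B : I -> V -> Prop) x :
  ~ common_bag_adj B x x.
Proof. intros [Hne _]; auto. Qed.

Definition common_bag_graph {V I : Type} (B : I -> V -> Prop) : graph V :=
  Graph (common_bag_adj B) (common_bag_adj_sym B) (common_bag_adj_irr B).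

Lemma reach_last_exit {V : Type} (R : V -> V -> Prop) (A D : V -> Prop) x y :
  reach R D x y -> A x -> ~ A y ->
  exists s t, A s /\ ~ A t /\ R s t /\ reach R (fun z => ~ A z) t y.
Proof.
  induction 1 as [|y z H IH Ryz _]; intros Ax HA; [contradiction|].
  destruct (classic (A y)) as [Ay|Ay].
  - exists y, z; repeat split; auto; apply reach_refl; exact HA.
  - destruct (IH Ax Ay) as [s [t [As [At [Rst Hr]]]]].
    exists s, t; repeat split; auto; eapply reach_step; eauto.
Qed.

Definition delete_edge {V : Type} (R : V -> V -> Prop) (s t x y : V) : Prop :=
  R x y /\ ~ (x = s /\ y = t) /\ ~ (x = t /\ y = s).

(** A shortest walk from [s] to [t] that does not use the edge would close with it to a cycle. *)
Lemma tree_edge_bridge {I : Type} (T : graph I) (s t : I) :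
  is_tree T -> adj T s t -> ~ reach (delete_edge (adj T) s t) (fun _ => True) s t.
Proof.
  intros [_ [_ Hacyc]] Hst Hr.
  destruct (reach_induced_path _ _ _ _ Hr) as [n [p [[P0 [Pn Hp]] [_ [Hinj _]]]]].
  assert (Hn : 2 <= n).
  { destruct n as [|[|n]]; [| |lia].
    - exfalso; apply (adj_irr T s); congruence.
    - destruct (Hp 0) as [_ [H _]]; [lia|]; exfalso; auto. }
  apply (Hacyc (n + 1) p); [lia|]; split.
  - intros i j Hi Hj; apply Hinj; lia.
  - intros i Hi; destruct (mod_succ_cases i (n + 1) Hi) as [[L ->]|[L ->]].
    + apply Hp; lia.
    + replace i with n by lia; rewrite P0, Pn; apply adj_sym; exact Hst.
Qed.

(* Two vertices in no common bag are separated by the intersection of the bags at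
   the ends of an edge of T leaving the subtree of the first vertex. *)
Lemma tree_decomposition_finitely_separable {V I : Type} (G : graph V) (T : graph I)
    (B : I -> V -> Prop) :
  tree_decomposition G T B ->
  (forall X : V -> Prop, infinite_set X ->
     exists v w, X v /\ X w /\ v <> w /\ ~ (exists t, B t v /\ B t w)) ->
  finitely_separable (common_bag_graph B).
Proof.
  intros [HT [_ [Hcov Hconn]]] HX x y Hxy Hadj.
  assert (Hdisj : forall t, B t x -> B t y -> False).
  { intros t Hx Hy; apply Hadj; split; eauto. }
  destruct (Hcov x) as [a Ha], (Hcov y) as [b Hb].
  destruct (proj1 (proj2 HT) a b) as [n [p Hp]].
  destruct (reach_last_exit (adj T) (fun t => B t x) (fun _ => True) a b)
    as [s [t [Hs [Ht [Hst Htb]]]]]; [eapply walk_reach; eauto|auto|eauto|].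
  set (F := fun v => B s v /\ B t v).
  (* Any two vertices of [F] share the bag at [s], so [F] cannot be infinite. *)
  assert (HF : finite_set F).
  { apply NNPP; intros H.
    destruct (HX F H) as [v [w [[Hv _] [[Hw _] [_ Hvw]]]]]; eauto. }
  destruct (finite_set_list F HF) as [l Hl].
  exists l; rewrite !Hl; repeat split.
  - intros [_ H]; auto.
  - intros [H _]; eauto.
  - set (R := delete_edge (adj T) s t).
    (* The bags of a vertex outside [F] stay connected without the edge [st], since they do not
       include both of its ends. So a walk from [x] avoiding [F] only meets bags on the side of
       [s]. *)
    assert (Hbag : forall v, ~ F v -> forall r r', B r v -> B r' v ->
              reach R (fun _ => True) r r').
    { intros v Hv r r' Hr Hr'.
      destruct (Hconn v r r' Hr Hr') as [m [q [Hq HB]]].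
      apply (walk_reach _ (fun r => B r v)) in Hq; auto.
      revert Hq; apply reach_mono; auto.
      intros u u' Hu Hu' E; split; [exact E|].
      split; intros [-> ->]; apply Hv; split; auto. }
    assert (Hreach : forall v, reach (adj (common_bag_graph B))
              (fun z => ~ In z l) x v ->
              forall r, B r v -> reach R (fun _ => True) s r).
    { induction 1 as [Hx|v w Hv IH [_ [r0 [Hv0 Hw0]]] Hw]; intros r Hr.
      - apply (Hbag x); auto; rewrite <- Hl; exact Hx.
      - apply reach_trans with r0; auto.
        apply (Hbag w); auto; rewrite <- Hl; exact Hw. }
    (* As a bag of [y], [b] would be on the side of [s]; by the choice of the last exit it is on the
       side of [t]. *)
    intros Hr; apply (tree_edge_bridge T s t HT Hst).
    apply reach_trans with b; [apply (Hreach y); auto|].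
    apply reach_sym; [intros u v [H1 [H2 H3]]; split; [apply adj_sym; auto|tauto]|].
    revert Htb; apply reach_mono; auto.
    intros u u' Hu Hu' E; split; [exact E|].
    split; intros [-> ->]; auto.
Qed.

Lemma tree_decomposition_no_K_aleph0 {V I : Type} (B : I -> V -> Prop) :
  (forall X : V -> Prop, infinite_set X ->
     exists v w, X v /\ X w /\ v <> w /\ ~ (exists t, B t v /\ B t w)) ->
  ~ has_K_aleph0 (common_bag_graph B).
Proof.
  intros HX [g [inj Hg]].
  destruct (HX _ (infinite_range g inj)) as [v [w [[i ->] [[j ->] [Hne H]]]]].
  apply H, (Hg i j); congruence.
Qed.

(** * Models with branch sets of finite radius *)

(** Finitely many [w] have index below [N0]. If each failed at some [N], all would fail at one
    common [M], because failure persists as [N] grows. *)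
Lemma pigeonhole_antitone {V : Type} (f : V -> nat) (R : V -> nat -> Prop) N0 :
  (forall x y, f x = f y -> x = y) ->
  (forall w N M, N <= M -> R w M -> R w N) ->
  (forall N, N0 <= N -> exists w, f w < N0 /\ R w N) ->
  exists w, f w < N0 /\ forall N, R w N.
Proof.
  intros inj anti H; apply NNPP; intros Hno.
  assert (Hb : forall k, k <= N0 ->
            exists M, N0 <= M /\ forall w, f w < k -> ~ R w M).
  { induction k as [|k IH]; intros Hk; [exists N0; split; [auto|lia]|].
    destruct IH as [M [HM IH]]; [lia|].
    destruct (classic (exists w, f w = k)) as [[w Hw]|Hw].
    - destruct (classic (forall N, R w N)) as [HR|HR];
        [exfalso; apply Hno; exists w; split; auto; lia|].
      apply not_all_ex_not in HR; destruct HR as [N HN].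
      exists (M + N); split; [lia|]; intros w' Hw' HR.
      destruct (Nat.eq_dec (f w') k) as [E|E].
      + apply HN; replace w with w' by (apply inj; congruence).
        apply anti with (M + N); auto; lia.
      + apply (IH w'); [lia|]; apply anti with (M + N); auto; lia.
    - exists M; split; [exact HM|]; intros w' Hw'; apply IH.
      assert (f w' <> k) by eauto; lia. }
  destruct (Hb N0 (le_n _)) as [M [HM Hw]].
  destruct (H M HM) as [w [Hw1 Hw2]]; exact (Hw w Hw1 Hw2).
Qed.

(* Let D N be the component of K[f >= N] containing all branch sets with no vertex
   of index below N.  The vertices adjacent to D N for all large N are pairwise
   inseparable by finite sets, hence form a clique; by induction on the radius,
   every branch set contains one of them. *)
Lemma finitely_separable_no_finite_radius_model {V : Type} (K : graph V) :
  countable V -> finitely_separable K -> ~ has_K_aleph0 K ->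
  ~ has_finite_radius_K_aleph0_model K.
Proof.
  intros [f inj] Hsep HK
    [X [E [HE [Esym [Hdisj [Hne [Hconn [Htouch Hrad]]]]]]]].
  (* Only finitely many of the disjoint branch sets can meet the finite set of vertices with index
     below [N]; the indices [S (k + i)] avoid [i]. *)
  assert (Hfar : forall i N, exists j, i <> j /\ forall v, X j v -> N <= f v).
  { intros i N; apply NNPP; intros Hno.
    assert (H : forall k, exists v, X (S (k + i)) v /\ f v < N).
    { intros k; apply NNPP; intros Hk; apply Hno; exists (S (k + i)).
      split; [lia|]; intros v Hv.
      destruct (le_lt_dec N (f v)); auto; exfalso; eauto. }
    destruct (functional_choice _ H) as [g Hg].
    apply (no_injection_into_list (seq 0 N) (fun k => f (g k))).
    - intros k k' Ek; apply inj in Ek.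
      destruct (Nat.eq_dec k k') as [|Hk]; auto; exfalso.
      apply (Hdisj (S (k + i)) (S (k' + i)) (g k)); [lia|apply Hg|].
      rewrite Ek; apply Hg.
    - intros k; apply in_seq; specialize (Hg k); lia. }
  set (A := fun N u => N <= f u).
  (* The union runs over all branch sets beyond [N]; these are connected and touch each other, so it
     is a single component, as [Dconn] shows. *)
  set (D := fun N z => exists j w, (forall v, X j v -> N <= f v) /\ X j w /\
              reach (adj K) (A N) w z).
  assert (Dge : forall N z, D N z -> N <= f z).
  { intros N z [j [w [_ [_ H]]]]; exact (reach_target _ _ _ _ H). }
  assert (Dconn : forall N z z', D N z -> D N z' -> reach (adj K) (A N) z z').
  { assert (HX : forall N j w w', (forall v, X j v -> N <= f v) -> X j w -> X j w' ->
              reach (adj K) (A N) w w').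
    { intros N j w w' Hj Hw Hw'; destruct (Hconn j w w' Hw Hw') as [n [p Hp]].
      apply (walk_reach _ (fun u => X j u)) in Hp.
      - revert Hp; apply reach_mono; [exact Hj|]; intros u v _ _ Huv; apply HE in Huv; apply Huv.
      - destruct Hp as [P0 [Pn Hp]]; intros [|k] Hk; [congruence|].
        apply (HE j (p k)); apply Hp; lia. }
    intros N z z' [j [w [Hj [Hw Hr]]]] [j' [w' [Hj' [Hw' Hr']]]].
    apply reach_trans with w; [apply reach_sym; auto; apply adj_sym|].
    apply reach_trans with w'; [|exact Hr'].
    destruct (Nat.eq_dec j j') as [->|Hjj]; [apply HX with j'; auto|].
    destruct (Htouch j j' Hjj) as [a [b [Ha [Hb Hab]]]].
    apply reach_trans with a; [apply HX with j; auto|].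
    apply reach_trans with b; [|apply HX with j'; auto].
    apply reach_edge; [apply (Hj a Ha)|apply (Hj' b Hb)|exact Hab]. }
  assert (Dmono : forall N M z, N <= M -> D M z -> D N z).
  { intros N M z L [j [w [Hj [Hw Hr]]]]; exists j, w; repeat split; auto.
    - intros v Hv; apply Hj in Hv; lia.
    - revert Hr; apply reach_mono; auto; unfold A; intros; lia. }
  assert (Dstep : forall N z u, D N z -> adj K u z -> N <= f u -> D N u).
  { intros N z u [j [w [Hj [Hw Hr]]]] Hu L; exists j, w; repeat split; auto.
    apply reach_step with z; auto; apply adj_sym; exact Hu. }
  (* By [Dstep], a vertex of [Cl N] with index at least [N] lies in [D N] itself. *)
  set (Cl := fun N u => D N u \/ exists z, D N z /\ adj K u z).
  assert (Clmono : forall N M z, N <= M -> Cl M z -> Cl N z).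
  { intros N M z L [H|[u [Hu Hzu]]]; [left|right; exists u]; eauto. }
  set (P := fun x => forall N, f x < N -> exists z, D N z /\ adj K x z).
  assert (HP : finite_set P).
  { apply NNPP; intros Hinf; apply HK; apply (infinite_clique_K_aleph0 K P Hinf).
    intros x y Px Py Hxy; apply NNPP; intros Hadj.
    destruct (Hsep x y Hxy Hadj) as [F [Hx [Hy Hr]]]; apply Hr.
    (* For [N] beyond [x], [y] and all of [F], the set [D N] misses [F] and links [x] to [y]. *)
    set (N := S (f x + f y + list_max (map f F))).
    assert (HN : forall u, N <= f u -> ~ In u F).
    { intros u Hu HuF.
      assert (H := proj1 (list_max_le (map f F) _) (le_n _)).
      rewrite Forall_forall in H; specialize (H (f u) (in_map f _ _ HuF)).
      unfold N in Hu; lia. }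
    destruct (Px N) as [a [Ha Hxa]]; [unfold N; lia|].
    destruct (Py N) as [b [Hb Hyb]]; [unfold N; lia|].
    apply reach_trans with a; [apply reach_edge; auto|].
    apply reach_step with b; [|apply adj_sym|]; auto.
    generalize (Dconn N a b Ha Hb); apply reach_mono; auto. }
  (* Induction on the distance [r] within which every [Cl N] is reached from [z] inside [X i]. *)
  assert (Hmeet : forall i r z, X i z ->
            (forall N, exists w n p, Cl N w /\ n <= r /\ walk (E i) z w n p) ->
            exists x, X i x /\ P x).
  { intros i; induction r as [r IH] using lt_wf_ind; intros z Hz Hw.
    destruct (classic (P z)) as [Pz|Pz]; [eauto|].
    apply not_all_ex_not in Pz; destruct Pz as [N0 Pz].
    apply imply_to_and in Pz; destruct Pz as [HN0 Pz].
    assert (Hout : ~ Cl N0 z).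
    { intros [H|H]; [apply Dge in H; lia|auto]. }
    (* For [N >= N0], a walk from [z] to [Cl N] enters [Cl N0] after at least one step. Finitely
       many vertices can be the entry, so one [u] has distance less than [r] to every [Cl N]. *)
    set (R := fun u N => X i u /\ exists w n p, Cl N w /\ n < r /\ walk (E i) u w n p).
    destruct (pigeonhole_antitone f R N0 inj) as [u [_ HR]].
    - intros w N M L [Hu [v [n [p [Hv H]]]]]; split; [exact Hu|].
      exists v, n, p; split; [eauto|exact H].
    - intros N L; destruct (Hw N) as [w [n [p [HCl [Hn [P0 [Pn Hp]]]]]]].
      destruct (least_nat (fun k => k <= n /\ Cl N0 (p k)) n) as [k [[Hk Hpk] Hmin]].
      { split; [lia|]; rewrite Pn; eauto. }
      destruct k as [|k]; [exfalso; apply Hout; congruence|].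
      assert (Hnk : ~ Cl N0 (p k)).
      { intros H; apply (Hmin k); [lia|split; [lia|exact H]]. }
      assert (Hstep : E i (p k) (p (S k))) by (apply Hp; lia).
      exists (p (S k)); split.
      (* An entry vertex of index at least [N0] would lie in [D N0], which puts its predecessor into
         [Cl N0] already. *)
      + destruct (le_lt_dec N0 (f (p (S k)))) as [Hge|]; [exfalso|assumption].
        apply Hnk; right; exists (p (S k)); split; [|apply (HE i); exact Hstep].
        destruct Hpk as [H|[v [Hv Hadj]]]; eauto.
      + split; [apply (HE i) in Hstep; apply Hstep|].
        exists w, (n - S k), (fun m => p (S k + m)).
        repeat split; [exact HCl|lia|f_equal; lia| |].
        * rewrite <- Pn; f_equal; lia.
        * intros m Hm; rewrite Nat.add_succ_r; apply Hp; lia.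
    - assert (Hr : 0 < r).
      { destruct (HR 0) as [_ [w [n [p [_ [L _]]]]]]; lia. }
      apply (IH (pred r)) with u; [lia|apply (HR 0)|].
      intros N; destruct (HR N) as [_ [w [n [p [H1 [H2 H3]]]]]].
      exists w, n, p; repeat split; auto; try lia; apply H3. }
  assert (Hall : forall i, exists x, X i x /\ P x).
  { intros i; destruct (Hrad i) as [c [r [Hc Hr]]]; apply (Hmeet i r c Hc).
    intros N; destruct (Hfar i N) as [j [Hij Hj]].
    destruct (Htouch i j Hij) as [a [b [Ha [Hb Hab]]]].
    destruct (Hr a Ha) as [n [p [Hn Hp]]].
    exists a, n, p; repeat split; auto; try apply Hp.
    right; exists b; split; [|exact Hab].
    exists j, b; repeat split; auto; apply reach_refl, (Hj b Hb). }
  destruct (functional_choice _ Hall) as [g Hg], HP as [l Hl].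
  apply (no_injection_into_list l g); [|intros i; apply Hl, Hg].
  intros i j Eg; destruct (Nat.eq_dec i j) as [|Hij]; auto; exfalso.
  apply (Hdisj i j (g i) Hij); [|rewrite Eg]; apply Hg.
Qed.

(** * Models in supergraphs and from subdivisions *)

Lemma finite_radius_model_mono {V : Type} (G K : graph V) :
  spanning_subgraph G K ->
  has_finite_radius_K_aleph0_model G -> has_finite_radius_K_aleph0_model K.
Proof.
  intros HGK [X [E [HE [H1 [H2 [H3 [H4 [H5 H6]]]]]]]].
  exists X, E; repeat split; auto.
  - apply (HE i x y H).
  - apply (HE i x y H).
  - apply HGK, (HE i x y H).
  - intros i j Hij; destruct (H5 i j Hij) as [x [y [Hx [Hy Hxy]]]].
    exists x, y; auto.
Qed.

(* Giving f i only the subdivided edges towards the finitely many f j with j < i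
   keeps the radius finite. *)
Lemma TK_aleph0_finite_radius_model {V : Type} (G : graph V) :
  has_TK_aleph0 G -> has_finite_radius_K_aleph0_model G.
Proof.
  intros [f [P [L [inj HP]]]].
  set (X := fun i x => x = f i \/ exists j k, j < i /\ 0 < k < L j i /\ x = P j i k).
  set (E := fun i x y => X i x /\ X i y /\ adj G x y).
  assert (Esym : forall i x y, E i x y -> E i y x).
  { intros i x y [Hx [Hy Hxy]]; repeat split; auto; apply adj_sym; exact Hxy. }
  assert (Xk : forall j i k, j < i -> 0 < k <= L j i -> X i (P j i k)).
  { intros j i k Hji Hk; destruct (HP j i Hji) as [_ [_ [HL _]]].
    destruct (Nat.eq_dec k (L j i)) as [->|]; [left; exact HL|right].
    exists j, k; repeat split; auto; lia. }
  (* Read backwards, [P j i] leads from the centre [f i] to [x] within [X i]. *)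
  assert (Hcenter : forall i x, X i x ->
            x = f i \/ exists j k, j < i /\ 0 < k < L j i /\
              walk (E i) (f i) x (L j i - k) (fun m => P j i (L j i - m))).
  { intros i x [->|[j [k [Hji [Hk ->]]]]]; [auto|right].
    destruct (HP j i Hji) as [_ [_ [HL [Hadj _]]]].
    exists j, k; repeat split; auto; try lia.
    - rewrite Nat.sub_0_r; exact HL.
    - f_equal; lia.
    - apply Xk; auto; lia.
    - apply Xk; auto; lia.
    - apply adj_sym; replace (L j i - k0) with (S (L j i - S k0)) by lia.
      apply Hadj; lia. }
  assert (Hreach : forall i x, X i x -> reach (E i) (fun _ => True) (f i) x).
  { intros i x Hx; destruct (Hcenter i x Hx) as [->|[j [k [_ [_ H]]]]].
    - apply reach_refl; auto.
    - apply (walk_reach _ _ _ _ _ _ H); auto. }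
  exists X, E; split; [|split; [|split; [|split; [|split; [|split]]]]].
  - auto.
  - exact Esym.
  - intros i j x Hij [->|[a [k [Ha [Hk ->]]]]] [Ex|[b [m [Hb [Hm Ex]]]]].
    + auto.
    + destruct (HP b j Hb) as [_ [_ [_ [_ [_ [H _]]]]]]; eapply H; eauto.
    + destruct (HP a i Ha) as [_ [_ [_ [_ [_ [H _]]]]]]; eapply H; eauto.
    + destruct (HP a i Ha) as [_ [_ [_ [_ [_ [_ H]]]]]].
      apply (H b j k m Hb); auto; congruence.
  - intros i; exists (f i); left; reflexivity.
  - intros i x y Hx Hy.
    destruct (reach_walk (E i) (fun _ => True) x y) as [n [p [Hp _]]]; [|eauto].
    apply reach_trans with (f i); [apply reach_sym|]; auto.
  - assert (H : forall i j, i < j -> exists x y, X i x /\ X j y /\ adj G x y).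
    { intros i j Hij; exists (P i j 0), (P i j 1).
      destruct (HP i j Hij) as [H1 [H0 [_ [Hadj _]]]]; repeat split.
      - left; exact H0.
      - apply Xk; auto; lia.
      - apply Hadj; lia. }
    intros i j Hij; destruct (Nat.lt_trichotomy i j) as [Lt|[Eq|Lt]]; auto.
    + contradiction.
    + destruct (H j i Lt) as [x [y [Hx [Hy Hxy]]]]; exists y, x.
      repeat split; auto; apply adj_sym; exact Hxy.
  - intros i; exists (f i), (list_max (map (fun j => L j i) (seq 0 i))).
    split; [left; reflexivity|]; intros x Hx.
    destruct (Hcenter i x Hx) as [->|[j [k [Hji [Hk H]]]]].
    + exists 0, (fun _ => f i); repeat split; lia.
    + exists (L j i - k), (fun m => P j i (L j i - m)); split; [|exact H].
      assert (Hm := proj1 (list_max_le (map (fun j => L j i) (seq 0 i)) _) (le_n _)).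
      rewrite Forall_forall in Hm; specialize (Hm (L j i)).
      assert (In (L j i) (map (fun j => L j i) (seq 0 i))).
      { apply in_map_iff; exists j; split; auto; apply in_seq; lia. }
      apply Hm in H0; lia.
Qed.

(** * Subdivided cliques from inseparable sets *)

(** Only inner vertices avoid [F], because in the greedy construction [F] contains the starting
    vertex of the path. *)
Definition avoiding_path {V : Type} (G : graph V) (x y : V) (F : list V)
    (L : nat) (p : nat -> V) : Prop :=
  1 <= L /\ p 0 = x /\ p L = y /\
  (forall k, k < L -> adj G (p k) (p (S k))) /\
  (forall k k', k <= L -> k' <= L -> p k = p k' -> k = k') /\
  (forall k, 0 < k < L -> ~ In (p k) F).

Lemma inseparable_avoiding_path {V : Type} (G : graph V) x y (F : list V) :
  x <> y -> ~ finitely_separated G x y -> exists L p, avoiding_path G x y F L p.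
Proof.
  intros Hxy Hsep.
  destruct (finite_set_list (fun z => In z F /\ z <> x /\ z <> y)) as [F' HF'];
    [exists F; tauto|].
  assert (Hr := not_separated_reach G x y F' Hsep).
  rewrite !HF' in Hr; specialize (Hr ltac:(tauto) ltac:(tauto)).
  destruct (reach_induced_path _ _ _ _ Hr) as [L [p [[P0 [PL Hp]] [HA [Hinj _]]]]].
  exists L, p; repeat split; auto.
  - destruct L; [congruence|lia].
  - intros k Hk HF; apply (HA k); [lia|apply HF'; repeat split; auto].
    + intros E; assert (k = 0); [apply Hinj; [lia|lia|congruence]|lia].
    + intros E; assert (k = L); [apply Hinj; [lia|lia|congruence]|lia].
Qed.

Definition path_vertices {V : Type} (n : nat) (L : nat -> nat) (p : nat -> nat -> V) :
    list V :=
  flat_map (fun i => map (p i) (seq 0 (S (L i)))) (seq 0 n).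

Lemma in_path_vertices {V : Type} n L (p : nat -> nat -> V) i k :
  i < n -> k <= L i -> In (p i k) (path_vertices n L p).
Proof.
  intros Hi Hk; apply in_flat_map; exists i; split; [apply in_seq; lia|].
  apply in_map, in_seq; lia.
Qed.

Definition avoiding_fan {V : Type} (G : graph V) (n : nat) (b : nat -> V) (v : V)
    (F : list V) (L : nat -> nat) (p : nat -> nat -> V) : Prop :=
  (forall i, i < n -> avoiding_path G (b i) v F (L i) (p i)) /\
  (forall i i' k k', i < i' -> i' < n -> 0 < k < L i -> 0 < k' < L i' ->
     p i k <> p i' k').

(** Each new path is made to avoid the vertices of all earlier paths as well as [F]. *)
Lemma inseparable_avoiding_fan {V : Type} (G : graph V) n (b : nat -> V) v F :
  (forall i, i < n -> b i <> v /\ ~ finitely_separated G (b i) v) ->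
  exists L p, avoiding_fan G n b v F L p.
Proof.
  induction n as [|n IH]; intros Hb.
  - exists (fun _ => 0), (fun _ _ => v); split; intros; lia.
  - destruct IH as [L [p [Hp Hdisj]]]; [intros i Hi; apply Hb; lia|].
    destruct (Hb n (Nat.lt_succ_diag_r n)) as [Hne Hsep].
    destruct (inseparable_avoiding_path G (b n) v (path_vertices n L p ++ F)
      Hne Hsep) as [L' [p' Hp']].
    exists (fun i => if i =? n then L' else L i), (fun i => if i =? n then p' else p i).
    split.
    + intros i Hi; destruct (Nat.eqb_spec i n) as [->|Hin]; [|apply Hp; lia].
      destruct Hp' as [H1 [H2 [H3 [H4 [H5 H6]]]]]; repeat split; auto.
      intros k Hk HF; apply (H6 k Hk), in_or_app; auto.
    + intros i i' k k' Hii' Hi'.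
      destruct (Nat.eqb_spec i n) as [|_]; [lia|].
      destruct (Nat.eqb_spec i' n) as [_|Hne']; [|apply Hdisj; lia].
      intros Hk Hk' E; destruct Hp' as [_ [_ [_ [_ [_ H6]]]]].
      apply (H6 k' Hk'), in_or_app; left; rewrite <- E.
      apply in_path_vertices; lia.
Qed.

(* Greedy choice: the n-th branch vertex is taken outside all vertices used so far,
   and is then joined to the earlier branch vertices by a fan avoiding them. *)
Lemma inseparable_set_TK_aleph0 {V : Type} (G : graph V) (U : V -> Prop) :
  infinite_set U ->
  (forall x y, U x -> U y -> x <> y -> ~ finitely_separated G x y) ->
  has_TK_aleph0 G.
Proof.
  intros HU Hsep.
  (* A state holds the number of branch vertices, their sequence and the list of used vertices. Its
     validity is a premise, so [step] is total with arbitrary values on invalid states. *)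
  destruct (functional_choice
    (fun (s : nat * ((nat -> V) * list V)) (r : V * ((nat -> nat) * (nat -> nat -> V))) =>
       (forall i, i < fst s -> U (fst (snd s) i) /\ In (fst (snd s) i) (snd (snd s))) ->
       U (fst r) /\ ~ In (fst r) (snd (snd s)) /\
       avoiding_fan G (fst s) (fst (snd s)) (fst r) (snd (snd s))
         (fst (snd r)) (snd (snd r)))) as [step Hstep].
  { intros [n [b F]]; simpl.
    destruct (infinite_set_avoids U F HU) as [v [Uv HvF]].
    destruct (classic (forall i, i < n -> U (b i) /\ In (b i) F)) as [Hb|Hb].
    - destruct (inseparable_avoiding_fan G n b v F) as [L [p Hp]].
      + intros i Hi; destruct (Hb i Hi) as [Ub Fb].
        assert (b i <> v) by congruence; auto.
      + exists (v, (L, p)); auto.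
    - exists (v, ((fun _ => 0), (fun _ _ => v))); intros H; contradiction. }
  destruct (infinite_set_avoids U nil HU) as [v0 _].
  set (st := fix st n : (nat -> V) * list V := match n with
    | 0 => ((fun _ => v0), nil)
    | S n => let r := step (n, st n) in
        ((fun i => if i =? n then fst r else fst (st n) i),
         fst r :: path_vertices n (fst (snd r)) (snd (snd r)) ++ snd (st n))
    end).
  set (f := fun n => fst (step (n, st n))).
  set (L := fun i j => fst (snd (step (j, st j))) i).
  set (P := fun i j => snd (snd (step (j, st j))) i).
  set (F := fun n => snd (st n)).
  assert (Hb : forall n i, i < n -> fst (st n) i = f i).
  { induction n as [|n IH]; intros i Hi; [lia|simpl].
    destruct (Nat.eqb_spec i n) as [->|]; [reflexivity|apply IH; lia]. }
  assert (Fmono : forall n m x, n <= m -> In x (F n) -> In x (F m)).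
  { induction 1; auto; intros Hx; right; apply in_or_app; right; auto. }
  assert (Ff : forall i n, i < n -> In (f i) (F n)).
  { intros i n Hi; apply (Fmono (S i)); [lia|left; reflexivity]. }
  assert (FP : forall i j k n, i < j -> j < n -> k <= L i j -> In (P i j k) (F n)).
  { intros i j k n Hi Hj Hk; apply (Fmono (S j)); [lia|right].
    apply in_or_app; left; unfold P; apply in_path_vertices; auto. }
  (* Strong induction: the state at stage [n] is valid once all earlier branch vertices are known to
     lie in [U]. *)
  assert (Hgood : forall n, U (f n) /\ ~ In (f n) (F n) /\
            avoiding_fan G n f (f n) (F n) (fun i => L i n) (fun i => P i n)).
  { induction n as [n IH] using lt_wf_ind.
    destruct (Hstep (n, st n)) as [H1 [H2 [H3 H4]]]; simpl in *.
    - intros i Hi; rewrite (Hb n i Hi); split; [apply IH; auto|apply Ff; auto].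
    - split; [exact H1|split; [exact H2|split; [|exact H4]]].
      intros i Hi; rewrite <- (Hb n i Hi); exact (H3 i Hi). }
  exists f, P, L; split.
  - assert (Hlt : forall i j, i < j -> f i <> f j).
    { intros i j Hij E; apply (proj1 (proj2 (Hgood j))); rewrite <- E; auto. }
    intros i j E; destruct (Nat.lt_trichotomy i j) as [H|[H|H]]; auto;
      exfalso; apply (Hlt _ _ H); auto.
  - intros i j Hij; destruct (Hgood j) as [_ [_ [Hfan Hdisj]]].
    destruct (Hfan i Hij) as [H1 [H2 [H3 [H4 [H5 H6]]]]]; repeat split; auto.
    (* Earlier branch vertices are among the used ones that the path avoids, [f j] is its end, and
       later ones are chosen off the path. *)
    + intros k m Hk E; destruct (Nat.lt_trichotomy m j) as [H|[->|H]].
      * apply (H6 k Hk); rewrite E; auto.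
      * assert (k = L i j) by (apply H5; [lia|lia|congruence]); lia.
      * apply (proj1 (proj2 (Hgood m))); rewrite <- E; apply FP; auto; lia.
    + intros i' j' k k' Hij' Hne Hk Hk' E.
      destruct (Hgood j') as [_ [_ [Hfan' _]]].
      destruct (Hfan' i' Hij') as [_ [_ [_ [_ [_ H6']]]]].
      (* Of two paths built at different stages the later one avoids the earlier; at the same stage
         they belong to one fan. *)
      destruct (Nat.lt_trichotomy j j') as [H|[<-|H]].
      * apply (H6' k' Hk'); rewrite <- E; apply FP; auto; lia.
      * destruct (Nat.lt_trichotomy i i') as [H|[<-|H]];
          [|congruence|]; eapply Hdisj; eauto.
      * apply (H6 k Hk); rewrite E; apply FP; auto; lia.
Qed.

(** * The fill-in graph and its chordality *)

(** In a finite graph this is the fill of vertex elimination in decreasing order of [f]. The choice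
    [z = y] gives the edges of [G]. *)
Definition low {V : Type} (G : graph V) (f : V -> nat) (x y : V) : Prop :=
  f x < f y /\ exists z, reach (adj G) (fun u => f y <= f u) y z /\ adj G x z.

Definition fill_in_adj {V : Type} (G : graph V) (f : V -> nat) (x y : V) : Prop :=
  low G f x y \/ low G f y x.

Lemma fill_in_adj_sym {V : Type} (G : graph V) f x y :
  fill_in_adj G f x y -> fill_in_adj G f y x.
Proof. unfold fill_in_adj; tauto. Qed.

Lemma fill_in_adj_irr {V : Type} (G : graph V) f x : ~ fill_in_adj G f x x.
Proof. intros [[H _]|[H _]]; lia. Qed.

Definition fill_in {V : Type} (G : graph V) (f : V -> nat) : graph V :=
  Graph (fill_in_adj G f) (fill_in_adj_sym G f) (fill_in_adj_irr G f).

(** Both [x] and [y] attach to the component of [t] above [f t]. Above the lower level [f y], the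
    vertex [y] itself joins that component, and [x] is still attached to it. *)
Lemma low_low {V : Type} (G : graph V) f x y t :
  low G f x t -> low G f y t -> f x < f y -> low G f x y.
Proof.
  intros [Hx [z [Hz Hxz]]] [Hy [w [Hw Hyw]]] Hxy; split; [exact Hxy|].
  exists z; split; [|exact Hxz].
  assert (Hm : forall u, reach (adj G) (fun u => f t <= f u) t u ->
                reach (adj G) (fun u => f y <= f u) t u).
  { intros u; apply reach_mono; auto; intros; lia. }
  apply Hm in Hz; apply Hm in Hw.
  apply reach_trans with t; [|exact Hz].
  apply reach_trans with w.
  - apply reach_edge; auto; exact (reach_target _ _ _ _ Hw).
  - apply reach_sym; [apply adj_sym|exact Hw].
Qed.

Lemma spanning_fill_in {V : Type} (G : graph V) f :
  (forall x y, f x = f y -> x = y) -> spanning_subgraph G (fill_in G f).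
Proof.
  intros inj x y Hxy; destruct (Nat.lt_trichotomy (f x) (f y)) as [H|[H|H]].
  - left; split; [exact H|]; exists y; split; auto; apply reach_refl; lia.
  - apply inj in H; subst; exfalso; exact (adj_irr G _ Hxy).
  - right; split; [exact H|]; exists x; split; [apply reach_refl; lia|].
    apply adj_sym; exact Hxy.
Qed.

Lemma fill_in_K_aleph0_TK {V : Type} (G : graph V) f :
  (forall x y, f x = f y -> x = y) ->
  has_K_aleph0 (fill_in G f) -> has_TK_aleph0 G.
Proof.
  intros inj [g [ginj Hg]].
  apply (inseparable_set_TK_aleph0 G _ (infinite_range g ginj)).
  intros x y [i ->] [j ->] Hxy [F [Hx [Hy Hr]]]; apply Hr.
  set (N := S (list_max (map f (g i :: g j :: F)))).
  assert (HN : forall u, In u (g i :: g j :: F) -> f u < N).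
  { intros u Hu.
    assert (H := proj1 (list_max_le (map f (g i :: g j :: F)) _) (le_n _)).
    rewrite Forall_forall in H; specialize (H (f u) (in_map f _ _ Hu)).
    unfold N; lia. }
  (* Some clique vertex [g k] lies beyond [N]. Its component above [f (g k)] misses [F], and both
     [g i] and [g j] attach to it. *)
  assert (Hk : exists k, N <= f (g k)).
  { apply NNPP; intros Hk.
    apply (no_injection_into_list (seq 0 N) (fun k => f (g k))); auto.
    intros k; apply in_seq; destruct (le_lt_dec N (f (g k))); [|lia].
    exfalso; eauto. }
  destruct Hk as [k Hk].
  assert (Hlow : forall m, In (g m) (g i :: g j :: F) -> low G f (g m) (g k)).
  { intros m Hm; apply HN in Hm.
    assert (m <> k) by (intros ->; lia).
    destruct (Hg m k H) as [|[H' _]]; [assumption|lia]. }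
  destruct (Hlow i) as [_ [a [Ha Hia]]]; [left; reflexivity|].
  destruct (Hlow j) as [_ [b [Hb Hjb]]]; [right; left; reflexivity|].
  assert (HF : forall u, reach (adj G) (fun u => f (g k) <= f u) (g k) u ->
            reach (adj G) (fun u => ~ In u F) (g k) u).
  { intros u; apply reach_mono; auto; intros v Hv HvF.
    assert (f v < N) by (apply HN; right; right; exact HvF); lia. }
  apply HF in Ha; apply HF in Hb.
  apply reach_trans with a.
  - apply reach_edge; auto; exact (reach_target _ _ _ _ Ha).
  - apply reach_step with b; [|apply adj_sym|]; auto.
    apply reach_trans with (g k); auto; apply reach_sym; auto; apply adj_sym.
Qed.

Lemma exists_argmax (h : nat -> nat) n :
  0 < n -> exists i, i < n /\ forall j, j < n -> h j <= h i.
Proof.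
  induction n as [|[|n] IH]; intros Hn; [lia| |].
  - exists 0; split; [lia|]; intros j Hj; replace j with 0 by lia; lia.
  - destruct IH as [i [Hi H]]; [lia|].
    destruct (le_lt_dec (h (S n)) (h i)); [exists i|exists (S n)];
      (split; [lia|]); intros j Hj;
      (destruct (Nat.eq_dec j (S n)) as [->|]; [lia|]);
      (assert (h j <= h i) by (apply H; lia)); lia.
Qed.

(** [a] precedes and [b] follows [i] on the cycle; in a triangle [a] also follows [b], whence the
    bound 4 in the last clause. *)
Lemma cyclic_neighbours i n : 3 <= n -> i < n ->
  exists a b, a < n /\ b < n /\ a <> b /\ a <> i /\ b <> i /\
    S a mod n = i /\ S i mod n = b /\ (4 <= n -> S b mod n <> a).
Proof.
  intros Hn Hi.
  exists (if i =? 0 then n - 1 else i - 1), (if S i =? n then 0 else S i).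
  destruct (Nat.eqb_spec i 0), (Nat.eqb_spec (S i) n); subst; repeat split; try lia;
    repeat match goal with |- context [S ?k mod ?m] =>
      let H := fresh in destruct (mod_succ_cases k m) as [[? H]|[? H]];
      [lia| |]; rewrite ?H end; lia.
Qed.

(** Both neighbours of the highest vertex of a cycle are low for it, so [low_low] makes them
    adjacent. *)
Lemma fill_in_chordal {V : Type} (G : graph V) f :
  (forall x y, f x = f y -> x = y) -> chordal (fill_in G f).
Proof.
  intros inj n c Hn [cinj Hc].
  destruct (exists_argmax (fun i => f (c i)) n) as [i [Hi Hmax]]; [lia|].
  destruct (cyclic_neighbours i n) as [a [b [Ha [Hb [Hab [Hai [Hbi [Ea [Eb Hba]]]]]]]]];
    [lia|exact Hi|].
  assert (Hlow : forall j, j < n -> adj (fill_in G f) (c j) (c i) ->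
            low G f (c j) (c i)).
  { intros j Hj [H|[H _]]; auto; specialize (Hmax j Hj); lia. }
  assert (La : low G f (c a) (c i)) by (apply Hlow; auto; rewrite <- Ea; auto).
  assert (Lb : low G f (c b) (c i))
    by (apply Hlow; auto; apply adj_sym; rewrite <- Eb; auto).
  exists a, b; repeat split; auto; try congruence.
  - destruct (Nat.lt_trichotomy (f (c a)) (f (c b))) as [H|[H|H]].
    + left; apply low_low with (c i); auto.
    + exfalso; apply Hab; auto.
    + right; apply low_low with (c i); auto.
  - intros E; apply (Hba Hn); auto.
Qed.

(** * Bags and the simplicial decomposition *)

(** The bag of [y] carries the index [f y]; numbers that are not values of [f] get empty bags. *)
Definition fill_in_bag {V : Type} (G : graph V) (f : V -> nat) (n : nat) (x : V) : Prop :=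
  exists y, f y = n /\ (x = y \/ low G f x y).

Lemma fill_in_bag_le {V : Type} (G : graph V) f n x : fill_in_bag G f n x -> f x <= n.
Proof. intros [y [<- [->|[H _]]]]; lia. Qed.

Lemma fill_in_bag_self {V : Type} (G : graph V) f x : fill_in_bag G f (f x) x.
Proof. exists x; auto. Qed.

Lemma fill_in_bag_low {V : Type} (G : graph V) f n x y :
  (forall x y, f x = f y -> x = y) ->
  fill_in_bag G f n x -> fill_in_bag G f n y -> f x < f y -> low G f x y.
Proof.
  intros inj [t [Et Hx]] [t' [Et' Hy]] Hxy.
  assert (t' = t) by (apply inj; congruence); subst t'.
  destruct Hx as [->|Hx], Hy as [->|Hy]; auto; try lia.
  - destruct Hy as [H _]; lia.
  - apply low_low with t; auto.
Qed.

Lemma fill_in_adj_bag {V : Type} (G : graph V) f x y :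
  (forall x y, f x = f y -> x = y) ->
  adj (fill_in G f) x y <->
  x <> y /\ exists n, fill_in_bag G f n x /\ fill_in_bag G f n y.
Proof.
  intros inj; split.
  - intros Hxy; split; [intros ->; exact (adj_irr _ _ Hxy)|].
    destruct Hxy as [H|H]; [exists (f y)|exists (f x)]; split;
      try apply fill_in_bag_self; eexists; eauto.
  - intros [Hne [n [Hx Hy]]].
    destruct (Nat.lt_trichotomy (f x) (f y)) as [H|[H|H]].
    + left; eapply fill_in_bag_low; eauto.
    + exfalso; auto.
    + right; eapply fill_in_bag_low; eauto.
Qed.

Lemma fill_in_bag_finite {V : Type} (G : graph V) f n :
  (forall x y, f x = f y -> x = y) -> finite_set (fill_in_bag G f n).
Proof.
  intros inj; apply NNPP; intros H; apply infinite_set_injection in H.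
  destruct H as [g [Hg ginj]].
  apply (no_injection_into_list (seq 0 (S n)) (fun i => f (g i))); auto.
  intros i; apply in_seq; specialize (fill_in_bag_le G f n _ (Hg i)); lia.
Qed.

Lemma fill_in_simplicial_decomposition {V : Type} (G : graph V) f :
  (forall x y, f x = f y -> x = y) ->
  fin_complete_simplicial_decomposition (fill_in G f).
Proof.
  intros inj; exists (fill_in_bag G f).
  split; [|split; [|split]].
  - intros n; apply fill_in_bag_finite; exact inj.
  - intros x; exists (f x); apply fill_in_bag_self.
  - intros x y; apply fill_in_adj_bag; exact inj.
  (* Bag [k] has only vertices of index at most [k]. So the bag indexed by the higher of [x] and [y]
     is among the first ones, and it contains both. *)
  - intros n x y Hx Hy Hxy [k [Hk Hkx]] [k' [Hk' Hky]].
    apply fill_in_bag_le in Hkx; apply fill_in_bag_le in Hky.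
    destruct (Nat.lt_trichotomy (f x) (f y)) as [H|[H|H]].
    + exists (f y); split; [lia|split; [|apply fill_in_bag_self]].
      exists y; split; auto; right; eapply fill_in_bag_low; eauto.
    + exfalso; auto.
    + exists (f x); split; [lia|split; [apply fill_in_bag_self|]].
      exists x; split; auto; right; eapply fill_in_bag_low; eauto.
Qed.

(** * The tree of the bags *)

Definition parent_adj (par : nat -> nat) (m n : nat) : Prop :=
  (m = par n /\ m < n) \/ (n = par m /\ n < m).

Lemma parent_adj_sym par m n : parent_adj par m n -> parent_adj par n m.
Proof. unfold parent_adj; tauto. Qed.

Lemma parent_adj_irr par n : ~ parent_adj par n n.
Proof. unfold parent_adj; lia. Qed.

Definition parent_graph (par : nat -> nat) : graph nat :=
  Graph (parent_adj par) (parent_adj_sym par) (parent_adj_irr par).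

(** The highest vertex of a cycle would have two distinct lower neighbours, but its only lower
    neighbour is its parent. *)
Lemma parent_graph_tree par :
  (forall n, 0 < n -> par n < n) -> is_tree (parent_graph par).
Proof.
  intros Hpar; split; [exact (inhabits 0)|split].
  - assert (H0 : forall n, reach (parent_adj par) (fun _ => True) 0 n).
    { induction n as [n IH] using lt_wf_ind.
      destruct n as [|n]; [apply reach_refl; exact I|].
      apply reach_step with (par (S n)); auto.
      - apply IH, Hpar; lia.
      - left; split; auto; apply Hpar; lia. }
    intros s t; destruct (reach_walk (parent_adj par) (fun _ => True) s t)
      as [n [p [Hp _]]]; [|eauto].
    apply reach_trans with 0; auto; apply reach_sym; auto; apply parent_adj_sym.
  - intros n c Hn [cinj Hc].
    destruct (exists_argmax c n) as [i [Hi Hmax]]; [lia|].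
    destruct (cyclic_neighbours i n) as [a [b [Ha [Hb [Hab [_ [_ [Ea [Eb _]]]]]]]]];
      [lia|exact Hi|].
    assert (Hp : forall j, j < n -> parent_adj par (c j) (c i) -> c j = par (c i)).
    { intros j Hj [[H _]|[_ H]]; auto; specialize (Hmax j Hj); lia. }
    apply Hab, cinj; auto.
    rewrite (Hp a Ha), (Hp b Hb); auto.
    + apply parent_adj_sym; rewrite <- Eb; apply Hc; exact Hi.
    + rewrite <- Ea; apply Hc; exact Ha.
Qed.

(** [m] is the highest index below [n] of a bag member, and the remaining lower members are low for
    that member. Without such a member, [m = 0]. *)
Lemma fill_in_bag_parent {V : Type} (G : graph V) f n :
  (forall x y, f x = f y -> x = y) ->
  exists m, (0 < n -> m < n) /\
    forall x, fill_in_bag G f n x -> f x < n -> fill_in_bag G f m x.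
Proof.
  intros inj.
  assert (H : forall k, k <= n -> exists m, (0 < n -> m < n) /\
            forall x, fill_in_bag G f n x -> f x < k -> fill_in_bag G f m x).
  { induction k as [|k IH]; intros Hk; [exists 0; split; auto; lia|].
    destruct (classic (exists y, f y = k /\ fill_in_bag G f n y)) as [[y [Ey Hy]]|Hno].
    - exists k; split; [lia|]; intros x Hx Hxk; exists y; split; [exact Ey|].
      destruct (Nat.eq_dec (f x) k); [left; apply inj; congruence|right].
      eapply fill_in_bag_low; eauto; lia.
    - destruct IH as [m [Hm IH]]; [lia|]; exists m; split; [exact Hm|].
      intros x Hx Hxk; apply IH; auto.
      assert (f x <> k) by eauto; lia. }
  apply (H n); lia.
Qed.

Lemma fill_in_tree_decomposition {V : Type} (G : graph V) f :
  (forall x y, f x = f y -> x = y) ->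
  exists T : graph nat, tree_decomposition G T (fill_in_bag G f).
Proof.
  intros inj.
  destruct (functional_choice _ (fun n => fill_in_bag_parent G f n inj)) as [par Hpar].
  exists (parent_graph par); split; [|split; [|split]].
  - apply parent_graph_tree; intros n; apply Hpar.
  - intros x y Hxy; apply (spanning_fill_in G f inj), fill_in_adj_bag in Hxy; auto.
    apply Hxy.
  - intros v; exists (f v); apply fill_in_bag_self.
  - intros v.
    (* Passing to parents keeps [v] in the bag until index [f v] is reached, so the bag at [f v] is
       the root of the subtree of [v]. *)
    assert (H : forall n, fill_in_bag G f n v ->
              reach (parent_adj par) (fun t => fill_in_bag G f t v) (f v) n).
    { induction n as [n IH] using lt_wf_ind; intros Hn.
      assert (Hle := fill_in_bag_le _ _ _ _ Hn).
      destruct (Nat.eq_dec n (f v)) as [->|Hne]; [apply reach_refl; exact Hn|].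
      destruct (Hpar n) as [H1 H2].
      apply reach_step with (par n); [apply IH| |]; auto.
      - apply H1; lia.
      - apply H2; auto; lia.
      - left; split; auto; apply H1; lia. }
    intros s t Hs Ht; apply (reach_walk (parent_adj par) (fun t => fill_in_bag G f t v)).
    apply reach_trans with (f v); auto.
    apply reach_sym; auto; apply parent_adj_sym.
Qed.

(** * The equivalences *)

Lemma no_finite_radius_model_of_separable_supergraph {V : Type} (G K : graph V) :
  countable V -> spanning_subgraph G K -> finitely_separable K -> ~ has_K_aleph0 K ->
  ~ has_finite_radius_K_aleph0_model G.
Proof.
  intros HV HGK Hsep HK H.
  apply (finitely_separable_no_finite_radius_model K HV Hsep HK).
  exact (finite_radius_model_mono G K HGK H).
Qed.

Theorem mainTheorem17 (V : Type) (G : graph V) (HV : countable V) :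
  let a := ~ has_TK_aleph0 G in
  let b := exists G' : graph V, spanning_subgraph G G' /\ chordal G' /\
             ~ has_K_aleph0 G' /\ fin_complete_simplicial_decomposition G' in
  let c := exists (I : Type) (T : graph I) (B : I -> V -> Prop),
             tree_decomposition G T B /\
             forall X : V -> Prop, infinite_set X ->
               exists v w, X v /\ X w /\ v <> w /\ ~ (exists t, B t v /\ B t w) in
  let d := exists G' : graph V, spanning_subgraph G G' /\ chordal G' /\
             ~ has_K_aleph0 G' in
  let e := exists (G' : graph V) (Q : Type) (P : Q -> V -> Prop),
             spanning_subgraph G G' /\ finite_partition P /\
             chordal (quotient G' P) /\ ~ has_K_aleph0 (quotient G' P) in
  let f := ~ has_finite_radius_K_aleph0_model G in
  (a <-> b) /\ (a <-> c) /\ (a <-> d) /\ (a <-> e) /\ (a <-> f).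
Proof.
  intros a b c d e f.
  destruct HV as [g inj].
  assert (HV : countable V) by (exists g; exact inj).
  assert (ab : a -> b).
  { intros Ha; exists (fill_in G g); split; [|split; [|split]].
    - apply spanning_fill_in; exact inj.
    - apply fill_in_chordal; exact inj.
    - intros H; apply Ha, (fill_in_K_aleph0_TK G g inj H).
    - apply fill_in_simplicial_decomposition; exact inj. }
  assert (ac : a -> c).
  { intros Ha; destruct (fill_in_tree_decomposition G g inj) as [T HT].
    exists nat, T, (fill_in_bag G g); split; [exact HT|].
    intros X HX; apply NNPP; intros Hno.
    apply Ha, (fill_in_K_aleph0_TK G g inj), (infinite_clique_K_aleph0 _ X HX).
    intros x y Hx Hy Hxy; apply fill_in_adj_bag; [exact inj|split; [exact Hxy|]].
    apply NNPP; intros Hbag; apply Hno; exists x, y; auto. }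
  assert (bd : b -> d) by (intros [K [H1 [H2 [H3 _]]]]; exists K; auto).
  assert (de : d -> e).
  (* The partition into singletons has [K] itself as quotient. *)
  { intros [K [H1 [H2 H3]]]; exists K, V, eq.
    assert (Hadj : forall x y, adj (quotient K eq) x y <-> adj K x y).
    { intros x y; split; [intros [_ [u [v [-> [-> H]]]]]; exact H|].
      intros H; split; [intros ->; exact (adj_irr K _ H)|]; exists x, y; auto. }
    split; [exact H1|split; [|split]].
    - split; [split|].
      + intros x; exists x; reflexivity.
      + intros x; exists x; split; auto.
      + intros x; exists [x]; intros y ->; left; reflexivity.
    - intros n p Hn [Hi Hp]; destruct (H2 n p Hn) as [i [j [Hin [Hjn [Hij H]]]]].
      + split; [exact Hi|]; intros i Hin; apply Hadj; auto.
      + exists i, j; repeat split; try apply Hadj; try apply H; auto.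
    - intros [h [hinj Hh]]; apply H3; exists h; split; [exact hinj|].
      intros i j Hij; apply Hadj; auto. }
  assert (ef : e -> f).
  { intros [G' [Q [P [H1 [H2 [H3 H4]]]]]].
    destruct (quotient_finitely_separable G' P H2) as [K [HK1 [HK2 HK3]]]; auto.
    - apply chordal_finitely_separable; auto.
    - apply (no_finite_radius_model_of_separable_supergraph G K); auto.
      intros x y Hxy; apply HK1, H1, Hxy. }
  assert (cf : c -> f).
  { intros [I [T [B [HT HX]]]].
    apply (no_finite_radius_model_of_separable_supergraph G (common_bag_graph B)); auto.
    - intros x y Hxy; split; [intros ->; exact (adj_irr G _ Hxy)|apply HT, Hxy].
    - exact (tree_decomposition_finitely_separable G T B HT HX).
    - exact (tree_decomposition_no_K_aleph0 B HX). }
  assert (fa : f -> a).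
  { intros Hf H; apply Hf, TK_aleph0_finite_radius_model, H. }
  (* The implications [a -> b -> d -> e -> f -> a] and [a -> c -> f] give all equivalences. *)
  tauto.
Qed.
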